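(* (Strong maximum principle) Let $(\Omega,\mu,d)$ be a metric measure space and let $X=L^p(\Omega)$ with $1\le p\le\infty$, or $X=\mathcal C_b(\Omega)$. Let $h\in L^\infty(\Omega)$ if $X=L^p(\Omega)$, and $h\in\mathcal C_b(\Omega)$ if $X=\mathcal C_b(\Omega)$. Let $K_Ju(x)=\int_\Omega J(x,y)u(y)\,dy$ and assume $K_J\in\mathcal L(X,X)$, that $J\ge0$ satisfies $$J(x,y)>0\quad\text{for all }x,y\in\Omega\text{ such that }d(x,y)<R$$ for some $R>0$, and that $\Omega$ is $R$-connected. Then for every nontrivial $u_0\ge0$ in $X$, the solution $u(t)$ of $$u_t(x,t)=(K_J-hI)u(x,t),\quad x\in\Omega,\ t>0,\qquad u(x,0)=u_0(x),\quad x\in\Omega,$$ is strictly positive for all $t>0$.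
   Context: A metric measure space $(\Omega,\mu,d)$ is a metric space $(\Omega,d)$ with a $\sigma$-finite, regular, complete Borel measure $\mu$ that associates a finite positive measure to the balls of $\Omega$. Integration $dy$ is with respect to $\mu$. $\mathcal C_b(\Omega)$ is the space of bounded continuous functions with the sup norm. The solution of the problem is $u(t)=e^{(K_J-hI)t}u_0\in X$. $\Omega$ is $R$-connected if for any $x,y\in\Omega$ there exist $N\in\mathbb N$ and points $x_0,\dots,x_N\in\Omega$ with $x_0=x$, $x_N=y$ and $d(x_{i-1},x_i)<R$ for $i=1,\dots,N$. *)

(* Defs.v *)
From HB Require Import structures.
From mathcomp Require Import all_boot all_order all_algebra.
From mathcomp Require Import all_classical all_reals all_analysis.

Set Implicit Arguments.
Unset Strict Implicit.
Unset Printing Implicit Defensive.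

Import Order.TTheory GRing.Theory Num.Theory.
Import numFieldNormedType.Exports.

Local Open Scope classical_set_scope.
Local Open Scope ring_scope.

(* The two structures are independent here: that open sets are measurable is
   part of [metric_measure] below. *)
#[short(type="metricMeasurableType")]
HB.structure Definition MetricMeasurable (d : measure_display)
    (K : numDomainType) := {T of Metric K T & Measurable d T}.

Section MetricMeasureSpace.
Context (d : measure_display) (R : realType) (T : metricMeasurableType d R).
Implicit Types (mu : {measure set T -> \bar R}) (u v : T -> R).

(* The measurable sets contain the Borel sets but, because of completeness, may
   be more numerous. Regularity is outer regularity by open sets and inner
   regularity by compact sets. *)
Record metric_measure mu : Prop := MetricMeasure {
  mm_borel : forall U : set T, open U -> measurable U;
  mm_sigma_finite : sigma_finite setT mu;
  mm_outer_regular : forall A : set T, measurable A ->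
    mu A = ereal_inf [set mu U | U in [set U | open U /\ A `<=` U]];
  mm_inner_regular : forall A : set T, measurable A ->
    mu A = ereal_sup [set mu K | K in [set K | compact K /\ K `<=` A]];
  mm_complete : measure_is_complete mu;
  mm_ball : forall (x : T) (r : R), 0 < r -> (0 < mu (ball x r) < +oo)%E
}.

Definition chain_connected (rho : R) : Prop :=
  forall x y : T, exists (N : nat) (z : nat -> T),
    [/\ z 0%N = x, z N = y
      & forall i : nat, (i < N)%N -> mdist (z i) (z i.+1) < rho].

Definition Cb : set (T -> R) := [set u | continuous u /\ bounded_fun u].

Definition sup_norm (u : T -> R) : \bar R :=
  ereal_sup [set `|u x|%:E | x in setT].

Definition KJ mu (J : T -> T -> R) (u : T -> R) : T -> R :=
  fun x => \int[mu]_y (J x y * u y).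

Definition KJ_sub_h mu (J : T -> T -> R) (h : T -> R) (u : T -> R) : T -> R :=
  fun x => KJ mu J u x - h x * u x.

(* A function space is given by its set [X] of elements and its norm [N]. An
   element of L^p is handled through its representatives in [Lfun mu p]: they
   are the measurable functions with finite L^p norm, so that equality in L^p
   is equality almost everywhere. *)
Definition bounded_operator (X : set (T -> R)) (N : (T -> R) -> \bar R)
    (A : (T -> R) -> T -> R) : Prop :=
  (forall u, X u -> X (A u)) /\
  exists C : R, forall u, X u -> (N (A u) <= C%:E * N u)%E.

(* [KJ_Lp] and [KJ_Cb] say that K_J belongs to L(X, X). The first conjunct is
   needed because \int is total: it says that the integral defining K_J u exists
   as a Lebesgue integral; K_J is then linear on X. *)
Definition KJ_Lp mu (p : \bar R) (J : T -> T -> R) : Prop :=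
  (forall u, u \in Lfun mu p ->
    {ae mu, forall x, mu.-integrable setT (fun y => (J x y * u y)%:E)}) /\
  bounded_operator [set u | u \in Lfun mu p]
    (fun u => 'N[mu]_p[EFin \o u]%E) (KJ mu J).

Definition KJ_Cb mu (J : T -> T -> R) : Prop :=
  (forall u, Cb u ->
    forall x, mu.-integrable setT (fun y => (J x y * u y)%:E)) /\
  bounded_operator Cb sup_norm (KJ mu J).

(* v = e^{tA} u0, the sum in X of the series of t^k / k! A^k u0;
   [exp_coeff t k] is t^k / k!. *)
Definition is_expop (X : set (T -> R)) (N : (T -> R) -> \bar R)
    (A : (T -> R) -> T -> R) (t : R) (u0 v : T -> R) : Prop :=
  X v /\
  (fun n : nat => N (v - \sum_(0 <= k < n) exp_coeff t k *: iter k A u0))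
    @ \oo --> 0%E.

(* u is the solution in X of u_t = (K_J - h I) u, u(0) = u0, that is,
   u(t) = e^{(K_J - h I) t} u0. *)
Definition solution_Lp mu (p : \bar R) (J : T -> T -> R) (h : T -> R)
    (u0 : T -> R) (u : R -> T -> R) : Prop :=
  forall t : R, 0 <= t ->
    is_expop [set v | v \in Lfun mu p] (fun v => 'N[mu]_p[EFin \o v]%E)
      (KJ_sub_h mu J h) t u0 (u t).

Definition solution_Cb mu (J : T -> T -> R) (h : T -> R)
    (u0 : T -> R) (u : R -> T -> R) : Prop :=
  forall t : R, 0 <= t ->
    is_expop Cb sup_norm (KJ_sub_h mu J h) t u0 (u t).

End MetricMeasureSpace.

Arguments chain_connected {d R} T rho.
Arguments Cb {d R} T.

(* Main.v *)
Require Import Defs.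
From HB Require Import structures.
From mathcomp Require Import all_boot all_order all_algebra.
From mathcomp Require Import all_classical all_reals all_analysis.
From mathcomp Require Import measurable_realfun ess_sup_inf.
From mathcomp Require Import ring lra.
Set Implicit Arguments.
Unset Strict Implicit.
Unset Printing Implicit Defensive.
Import Order.TTheory GRing.Theory Num.Theory.
Import numFieldNormedType.Exports.
Local Open Scope classical_set_scope.
Local Open Scope ring_scope.

(** Let [L = K_J - h] and choose a constant [M >= 0] with [h <= M]. The operator
    [L + M = K_J + (M - h)] preserves nonnegativity, and
    [e^{tL} = e^{-Mt} e^{t(L + M)}]. All the terms of the exponential series of
    [t(L + M)] at [u0 >= 0] are nonnegative, so for every [m]
    [[
      e^{Mt} u(t) >= t^m / m! (L + M)^m u0 >= t^m / m! K_J^m u0,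
    ]]
    and it is enough to find, near each point, a power [m] for which the
    right-hand side is positive ([expop_ge_shifted_iter]).

    The powers of [K_J] spread positivity by [rho] at each step. If a
    nonnegative [w] does not vanish almost everywhere on any ball centred at
    [x0], then [K_J w > 0] on the ball of radius [rho] around [x0], because for
    [x] in it [J x y] is positive as soon as [y] is close to [x0] ([KJ_gt0]).
    Balls have positive measure, so every point of that ball may serve as the
    next [x0] ([ess_support_gt0]). Following a chain with steps shorter than
    [rho] reaches the ball of radius [rho] around any point of the space
    ([expop_gt0_on_balls]).

    In L^p the first [x0], and at the end the passage from positivity on each
    ball to positivity almost everywhere, both come from [ae_of_locally_ae]: by
    inner regularity a set of positive measure contains a compact set of
    positive measure, which finitely many balls cover.

    The identity between exponentials is derived from the convergence of the
    series of [e^{tL} u0] alone. The Cauchy product of that series with the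
    scalar series of [e^{Mt}] has, by the binomial formula, the partial sums of
    the series of [e^{t(L + M)} u0] ([sum_exp_coeff_binomial]), and it converges
    because the convolution of a summable sequence with a null sequence tends to
    zero ([convolution_cvg0]).

    L^p and the continuous functions are treated together. A filter [F] on the
    space says what holds for a function: almost everywhere for L^p, everywhere
    for continuous functions. Convergence in norm is then only required to
    preserve inequalities that hold along [F] ([lattice_seminorm]). *)

(** * Binomial identities and convolution of sequences *)

(** Pascal's rule. When [a i] stands for [L^i u0], the right-hand side is the
    action of [L + M] on the binomial expansion of [(L + M)^k u0]. *)
Lemma binomial_shift (R : comPzRingType) (M : R) (a : nat -> R) (k : nat) :
  \sum_(i < k.+2) 'C(k.+1, i)%:R * M ^+ (k.+1 - i) * a i =
  \sum_(i < k.+1) 'C(k, i)%:R * M ^+ (k - i) * a i.+1 +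
  M * \sum_(i < k.+1) 'C(k, i)%:R * M ^+ (k - i) * a i.
Proof.
rewrite big_ord_recl bin0 subn0.
rewrite (eq_bigr (fun i : 'I_k.+1 =>
  'C(k, i.+1)%:R * M ^+ (k - i) * a i.+1 +
  'C(k, i)%:R * M ^+ (k - i) * a i.+1)); last first.
  by move=> i _; rewrite lift0 binS natrD subSS !mulrDl.
rewrite big_split /= addrA [RHS]addrC; congr (_ + _).
have -> : 1%:R * M ^+ k.+1 * a 0%N +
    \sum_(i < k.+1) 'C(k, i.+1)%:R * M ^+ (k - i) * a i.+1 =
    \sum_(i < k.+2) 'C(k, i)%:R * M ^+ (k.+1 - i) * a i.
  by rewrite [RHS]big_ord_recl bin0 subn0.
rewrite big_ord_recr /= bin_small // !mul0r addr0 mulr_sumr.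
apply: eq_bigr => i _; rewrite subSn -1?ltnS // exprS.
ring.
Qed.

Lemma sum_triangle (V : nmodType) (f : nat -> nat -> V) (n : nat) :
  \sum_(k < n) \sum_(i < k.+1) f i (k - i)%N =
  \sum_(j < n) \sum_(i < n - j) f i j.
Proof.
elim: n => [|n IH]; first by rewrite !big_ord0.
rewrite big_ord_recr /= IH [RHS]big_ord_recr /= subSnn big_ord1.
have -> : \sum_(i < n) \sum_(i0 < n.+1 - i) f i0 i =
    \sum_(i < n) \sum_(i0 < n - i) f i0 i + \sum_(i < n) f (n - i)%N i.
  rewrite -big_split /=; apply: eq_bigr => i _.
  by rewrite subSn 1?ltnW // big_ord_recr.
rewrite -addrA; congr (_ + _).
rewrite (reindex_inj rev_ord_inj) big_ord_recr /= subnn subn0; congr (_ + _).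
by apply: eq_bigr => i _; rewrite subSS subKn // ltnW.
Qed.

(** The partial sums of the product of two exponential series. They must be
    grouped by total degree: the left-hand side is then a combination of the
    binomial expansions, which are nonnegative in the application although the
    [a i] have no sign. *)
Lemma sum_exp_coeff_binomial (R : realType) (M t : R) (a : nat -> R) (n : nat) :
  \sum_(k < n) exp_coeff t k *
     (\sum_(i < k.+1) 'C(k, i)%:R * M ^+ (k - i) * a i) =
  \sum_(j < n) exp_coeff (M * t) j * \sum_(i < n - j) exp_coeff t i * a i.
Proof.
under [RHS]eq_bigr do rewrite mulr_sumr.
rewrite -(sum_triangle
  (fun i j => exp_coeff (M * t) j * (exp_coeff t i * a i))).
apply: eq_bigr => k _; rewrite mulr_sumr; apply: eq_bigr => i _.
have ik : (i <= k)%N by rewrite -ltnS.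
rewrite /exp_coeff /= exprMn.
have -> : t ^+ k = t ^+ i * t ^+ (k - i) by rewrite -exprD subnKC.
have f0 (m : nat) : m`!%:R != 0 :> R by rewrite pnatr_eq0 -lt0n fact_gt0.
rewrite -(bin_fact ik) !natrM.
field.
by rewrite !f0 pnatr_eq0 -lt0n bin_gt0 ik.
Qed.

(** The sum is cut at a fixed [q]: before it [e] is taken at large indices, and
    after it the tail of the series of [c] is small. *)
Lemma convolution_cvg0 (R : realType) (c e : R^nat) (S : R) :
    (forall j, 0 <= c j) -> series c @ \oo --> S ->
    (forall k, 0 <= e k) -> e @ \oo --> (0 : R) ->
  (fun n => \sum_(j < n) c j * e (n - j)%N) @ \oo --> (0 : R).
Proof.
move=> c0 cS e0 ecv.
have ndc : {homo series c : n m / (n <= m)%N >-> n <= m}.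
  by apply: nondecreasing_series => i _ _.
have leS n : series c n <= S.
  rewrite -(cvg_lim _ cS) //.
  by apply: nondecreasing_cvgn_le => //; apply/cvg_ex; exists S.
have S0 : 0 <= S by apply: le_trans (leS 0%N); rewrite /series /= big_geq.
have [E [E0 eE]] : exists E, 0 <= E /\ forall k, e k <= E.
  have [E [_ HE]] := cvg_seq_bounded (cvgP _ ecv).
  exists (`|E| + 1); split; first by rewrite addr_ge0.
  move=> k; apply: le_trans (ler_norm _) _.
  by apply: (HE (`|E| + 1)) => //; rewrite (le_lt_trans (ler_norm _)) ?ltrDl.
have SE0 : 0 < S + E + 1 by rewrite ltr_wpDl // addr_ge0.
apply/cvgrPdist_le => d d0.
pose u := d / (S + E + 1).
have u0 : 0 < u by rewrite divr_gt0.
have /cvgrPdist_le/(_ u u0)[n1 _ H1] := ecv.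
have /cvgrPdist_le/(_ u u0)[n2 _ H2] := cS.
pose q := maxn n1 n2.
exists (q + q)%N => //= n /= qn.
have qn' : (q <= n)%N by apply: leq_trans qn; exact: leq_addr.
rewrite sub0r normrN ger0_norm; last first.
  by apply: sumr_ge0 => j _; rewrite mulr_ge0.
rewrite -(big_mkord xpredT (fun j => c j * e (n - j)%N)) /=.
rewrite (big_cat_nat (n := q)) //=.
have h1 : \sum_(0 <= j < q) c j * e (n - j)%N <= S * u.
  apply: (@le_trans _ _ (series c q * u)); last by rewrite ler_wpM2r // ltW.
  rewrite /series /= mulr_suml; apply: ler_sum_nat => j /andP[_ jq].
  apply: ler_wpM2l => //.
  have /= := H1 (n - j)%N; rewrite sub0r normrN ger0_norm //; apply.
  rewrite (leq_trans (leq_maxl n1 n2)) // -/q leq_subRL.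
    by rewrite (leq_trans _ qn) // leq_add2r ltnW.
  by rewrite (leq_trans (ltnW jq)).
have h2 : \sum_(q <= j < n) c j * e (n - j)%N <= E * u.
  apply: (@le_trans _ _ (E * (series c n - series c q))); last first.
    apply: ler_wpM2l => //.
    have := H2 q (leq_maxr _ _); rewrite /= ger0_norm ?subr_ge0 //.
    by have := leS n; lra.
  rewrite /series /= [X in _ * (X - _)](big_cat_nat (n := q)) //=.
  rewrite addrAC subrr add0r mulr_sumr.
  by apply: ler_sum => j _; rewrite mulrC ler_wpM2r.
have : (S + E + 1) * u = d by rewrite /u mulrC divfK // gt_eqF.
by move: h1 h2; lra.
Qed.

(** * Lower bounds for the exponential of an operator *)

(** The last field is what remains of the order structure of the norm. It says
    that a function dominated along [F] by the absolute values of arbitrarily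
    small elements is nonpositive; thus limits in [N] respect inequalities, for
    the essential supremum and the L^p norms as well as for the supremum. *)
Record lattice_seminorm (R : realType) (T : Type) (F : set_system T)
    (X : set (T -> R)) (N : (T -> R) -> \bar R) : Prop := LatticeSeminorm {
  ls_zero : X 0;
  ls_lin : forall a f g, X f -> X g -> X (a *: f + g);
  ls_fin : forall f, X f -> N f \is a fin_num;
  ls_ge0 : forall f, (0 <= N f)%E;
  ls_triangle : forall f g, X f -> X g -> (N (f + g)%R <= N f + N g)%E;
  ls_scale : forall a f, X f -> N (a *: f) = (`|a|%:E * N f)%E;
  ls_le0 : forall g, X g ->
    (forall e : R, 0 < e ->
       exists2 r, X r /\ (N r <= e%:E)%E & F [set x | g x <= `|r x|]) ->
    F [set x | g x <= 0]
}.

Section LowerBound.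
Context (R : realType) (T : Type) (F : set_system T) {FF : Filter F}.
Context (X : set (T -> R)) (N : (T -> R) -> \bar R).
Hypothesis NX : lattice_seminorm F X N.

Let X0 : X 0 := ls_zero NX.

Let XD f g : X f -> X g -> X (f + g).
Proof. by move=> Xf Xg; rewrite -[f]scale1r; exact: ls_lin NX _ _ _ _ _. Qed.

Let XZ a f : X f -> X (a *: f).
Proof. by move=> Xf; rewrite -[_ *: _]addr0; exact: ls_lin NX _ _ _ _ _. Qed.

Let XB f g : X f -> X g -> X (f - g).
Proof. by move=> Xf Xg; rewrite -scaleN1r; apply: XD => //; exact: XZ. Qed.

Let Xsum (I : Type) (s : seq I) (f : I -> T -> R) :
  (forall i, X (f i)) -> X (\sum_(i <- s) f i).
Proof. by move=> Xf; elim/big_ind : _ => // *; exact: XD. Qed.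

Let seminorm_sum (n : nat) (f : nat -> T -> R) : (forall i, X (f i)) ->
  fine (N (\sum_(i < n) f i)) <= \sum_(i < n) fine (N (f i)).
Proof.
move=> Xf; elim: n => [|n IH].
  by rewrite !big_ord0 -(scale0r 0) (ls_scale NX) // normr0 mul0e.
rewrite !big_ord_recr /=; apply: le_trans (lerD IH (lexx _)).
have Xs : X (\sum_(i < n) f i) by exact: Xsum.
rewrite -fineD ?(ls_fin NX) // fine_le ?fin_numD ?(ls_fin NX) //.
  exact: XD.
exact: ls_triangle NX _ _ _ _.
Qed.

Context (L : (T -> R) -> T -> R).
Hypothesis L_X : forall f, X f -> X (L f).
Hypothesis L_lin : forall a f g w, X f -> X g -> X w ->
  F [set x | w x = a * f x + g x] -> F [set x | L w x = a * L f x + L g x].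

Lemma L_sum (n : nat) (c : nat -> R) (f : nat -> T -> R) (w : T -> R) :
  (forall i, X (f i)) -> X w ->
  F [set x | w x = \sum_(i < n) c i * f i x] ->
  F [set x | L w x = \sum_(i < n) c i * L (f i) x].
Proof.
move=> Xf; elim: n w => [|n IH] w Xw Fw.
  (* A null [w] satisfies [w = - w + w], hence [L w = - L w + L w = 0]. *)
  have := @L_lin (-1) w w w Xw Xw Xw.
  have Fw' : F [set x | w x = -1 * w x + w x].
    by apply: filterS Fw => x /=; rewrite big_ord0 => ->; rewrite mulr0 addr0.
  move=> /(_ Fw'); apply: filterS => x /=; rewrite big_ord0 => ->.
  by rewrite mulN1r addNr.
pose w' := \sum_(i < n) c i *: f i.
have Xw' : X w' by apply: Xsum => i; exact: XZ.
have w'E x : w' x = \sum_(i < n) c i * f i x by rewrite /w' fct_sumE.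
have := @L_lin (c n) (f n) w' w (Xf n) Xw' Xw.
have Fw' : F [set x | w x = c n * f n x + w' x].
  by apply: filterS Fw => x /=; rewrite big_ord_recr /= w'E addrC.
move=> /(_ Fw') H1.
have H2 : F [set x | L w' x = \sum_(i < n) c i * L (f i) x].
  by apply: IH => //; exact: nearW.
apply: filterS2 H1 H2 => x /= -> ->.
by rewrite big_ord_recr /= addrC.
Qed.

Context (u0 : T -> R) (Xu0 : X u0) (M : R).

Definition shifted_iter (k : nat) : T -> R :=
  iter k (fun w => L w + M *: w) u0.

Lemma shifted_iter_X k : X (shifted_iter k).
Proof.
by elim: k => //= k IH; apply: XD; [exact: L_X|exact: XZ].
Qed.

Lemma iter_X k : X (iter k L u0).
Proof. by elim: k => //= k IH; exact: L_X. Qed.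

Lemma shifted_iterE k :
  F [set x | shifted_iter k x =
     \sum_(i < k.+1) 'C(k, i)%:R * M ^+ (k - i) * iter i L u0 x].
Proof.
elim: k => [|k IH].
  by apply: nearW => x /=; rewrite big_ord1 bin0 subn0 expr0 !mul1r.
have := L_sum (c := fun i => 'C(k, i)%:R * M ^+ (k - i)) iter_X
  (shifted_iter_X k) IH.
apply: filterS2 IH => x /= IHx Lx.
by rewrite (binomial_shift M (fun i => iter i L u0 x)) /= -IHx -Lx.
Qed.

(** [e^{Mt} v] dominates each term of the series of [e^{t(L + M)} u0], all of
    them being nonnegative. The remainder [r n] below is the difference between
    [e^{Mt} v] and the [n]-th partial sum of the Cauchy product; its seminorm is
    at most the remainder of the scalar series times the seminorm of [v], plus
    the convolution of [exp_coeff (M * t)] with the remainders of the series of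
    [e^{tL} u0]. *)
Theorem expop_ge_shifted_iter (t : R) (v : T -> R) (m : nat) :
    0 <= M -> 0 <= t -> X v ->
    (fun n : nat => N (v - \sum_(0 <= k < n) exp_coeff t k *: iter k L u0))
      @ \oo --> 0%E ->
    (forall k, F [set x | 0 <= shifted_iter k x]) ->
  F [set x | exp_coeff t m * shifted_iter m x <= expR (M * t) * v x].
Proof.
move=> M0 t0 Xv vcv b0.
pose S n := \sum_(0 <= k < n) exp_coeff t k *: iter k L u0.
have XS n : X (S n).
  by apply: Xsum => k; apply: XZ; exact: iter_X.
have SE n x : S n x = \sum_(k < n) exp_coeff t k * iter k L u0 x.
  by rewrite /S big_mkord fct_sumE.
pose c := exp_coeff (M * t).
have c0 j : 0 <= c j by apply: exp_coeff_ge0; rewrite mulr_ge0.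
have ccv : series c @ \oo --> expR (M * t) by exact: is_cvg_series_exp_coeff.
pose e k := fine (N (v - S k)).
have ecv : e @ \oo --> (0 : R) by exact: (@fine_cvg _ _ _ _ _ 0 vcv).
have e0 k : 0 <= e k by apply: fine_ge0; exact: ls_ge0 NX _.
pose r n := expR (M * t) *: v - \sum_(j < n) c j *: S (n - j)%N.
have rE n : r n = (expR (M * t) - series c n) *: v +
    \sum_(j < n) c j *: (v - S (n - j)%N).
  rewrite /r /series /= big_mkord scalerBl -addrA; congr (_ + _).
  rewrite scaler_suml -sumrN -[in RHS]sumrN -big_split /=.
  by apply: eq_bigr => j _; rewrite scalerBr addKr.
have Xr n : X (r n).
  by apply: XB; [exact: XZ|apply: Xsum => j; exact: XZ].
have rle n : fine (N (r n)) <= `|expR (M * t) - series c n| * fine (N v) +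
    \sum_(j < n) c j * e (n - j)%N.
  have Xt : X (\sum_(j < n) c j *: (v - S (n - j)%N)).
    by apply: Xsum => j; apply: XZ; exact: XB.
  have Xv' : X ((expR (M * t) - series c n) *: v) by exact: XZ.
  rewrite rE; apply: (@le_trans _ _ (fine (N ((expR (M * t) - series c n) *: v))
    + fine (N (\sum_(j < n) c j *: (v - S (n - j)%N))))).
    rewrite -fineD ?(ls_fin NX) // fine_le ?fin_numD ?(ls_fin NX) //.
      exact: XD.
    exact: ls_triangle NX _ _ _ _.
  apply: lerD; first by rewrite (ls_scale NX) // fineM // (ls_fin NX).
  apply: le_trans
    (seminorm_sum (f := fun j => c j *: (v - S (n - j)%N)) _ _) _.
    by move=> j; apply: XZ; exact: XB.
  apply: ler_sum => j _; rewrite (ls_scale NX) ?fineM ?(ls_fin NX) //.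
  - by rewrite /= ger0_norm.
  - exact: XB.
  - exact: XB.
have rcv : (fun n => `|expR (M * t) - series c n| * fine (N v) +
    \sum_(j < n) c j * e (n - j)%N) @ \oo --> (0 : R).
  have cv1 : (fun n => `|expR (M * t) - series c n| * fine (N v)) @ \oo -->
      (0 : R).
    rewrite -(mul0r (fine (N v))); apply: cvgM; last exact: cvg_cst.
    apply/norm_cvg0P; rewrite -(subrr (expR (M * t))).
    by apply: cvgB => //; exact: cvg_cst.
  have := cvgD cv1 (convolution_cvg0 c0 ccv e0 ecv); rewrite addr0 => H.
  exact: H.
pose g := exp_coeff t m *: shifted_iter m - expR (M * t) *: v.
have Xg : X g by apply: XB; apply: XZ => //; exact: shifted_iter_X.
suff : F [set x | g x <= 0] by apply: filterS => x /=; rewrite subr_le0.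
apply: (ls_le0 NX) => // d d0.
have /cvgrPdist_le/(_ d d0)[n0 _ Hn0] := rcv.
(* The partial sum must be long enough to contain the term of index [m]. *)
pose n := maxn n0 m.+1.
exists (r n).
  split => //; rewrite -(fineK (ls_fin NX (Xr n))) lee_fin.
  apply: le_trans (rle n) _; apply: le_trans (ler_norm _) _.
  by have := Hn0 n (leq_maxl _ _); rewrite /= sub0r normrN.
have : F [set x | forall k : 'I_n, 0 <= shifted_iter k x /\ shifted_iter k x =
     \sum_(i < k.+1) 'C(k, i)%:R * M ^+ (k - i) * iter i L u0 x].
  by apply: filter_forall => k; apply: filterS2 (b0 k) (shifted_iterE k).
apply: filterS => x /= bx.
have := sum_exp_coeff_binomial M t (fun i => iter i L u0 x) n.
rewrite (eq_bigr (fun k : 'I_n => exp_coeff t k * shifted_iter k x)); last first.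
  by move=> k _; have [_ ->] := bx k.
have -> : \sum_(j < n) exp_coeff (M * t) j *
    \sum_(i < n - j) exp_coeff t i * iter i L u0 x =
    (\sum_(j < n) c j *: S (n - j)%N) x.
  by rewrite fct_sumE; apply: eq_bigr => j _; rewrite -SE.
move=> TE.
have mn : (m < n)%N by exact: leq_maxr.
have gT : exp_coeff t m * shifted_iter m x <=
    (\sum_(j < n) c j *: S (n - j)%N) x.
  rewrite -TE (bigD1 (Ordinal mn)) //= lerDl; apply: sumr_ge0 => k _.
  by rewrite mulr_ge0 ?exp_coeff_ge0 //; have [] := bx k.
rewrite -normrN; apply: le_trans (ler_norm _).
rewrite /r /g /= opprB; apply: lerB => //.
Qed.

End LowerBound.

Arguments shifted_iter : simpl never.


(** * Spreading of positivity *)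

Lemma metric_ball_open (R : realFieldType) (T : metricType R) (x : T) (r : R) :
  open (ball x r).
Proof.
rewrite openE => y; rewrite ballEmdist /= => xy.
apply/nbhs_ballP; exists (r - mdist x y) => /=; first by rewrite subr_gt0.
move=> z; rewrite !ballEmdist /= => yz.
by apply: le_lt_trans (metric_triangle _ y _) _; lra.
Qed.

Section Positivity.
Context (R : realType) (d : measure_display) (Omega : metricMeasurableType d R).
Context (mu : {measure set Omega -> \bar R}).
Context (J : Omega -> Omega -> R).

(** For nonnegative [w], the support of the measure [w mu]. It is defined by
    negligibility so that it makes sense without measurability of [w]. *)
Definition ess_support (w : Omega -> R) : set Omega :=
  [set x | forall r : R, 0 < r -> ~ {ae mu, forall y, ball x r y -> w y = 0}].

Let Jint (w : Omega -> R) (x : Omega) : Prop :=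
  mu.-integrable setT (fun y => (J x y * w y)%:E).

(** Integrability at [x] is assumed of each function separately: without it the
    integral is total but not additive. *)
Lemma KJ_lin (a : R) (f g w : Omega -> R) (x : Omega) :
    Jint f x -> Jint g x -> Jint w x ->
    {ae mu, forall y, w y = a * f y + g y} ->
  KJ mu J w x = a * KJ mu J f x + KJ mu J g x.
Proof.
move=> fi gi wi wE; rewrite /KJ.
have afi : mu.-integrable setT (EFin \o (fun y => a * (J x y * f y))).
  exact: (integrableZl measurableT a fi).
rewrite -RintegralZl // -RintegralD //.
have afgi : mu.-integrable setT
    (fun y => (a * (J x y * f y) + J x y * g y)%:E).
  exact: (integrableD measurableT afi gi).
rewrite /Rintegral; congr fine; apply: ae_eq_integral => //.
- by case/integrableP: wi.
- by case/integrableP: afgi.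
- by apply: filterS wE => y /= wy _; rewrite wy; congr EFin; ring.
Qed.

Hypothesis J_ge0 : forall x y, 0 <= J x y.

Let KJ_abs (w : Omega -> R) (x : Omega) : Jint w x ->
  {ae mu, forall y, 0 <= w y} ->
  KJ mu J w x = fine (\int[mu]_y `|(J x y * w y)%:E|).
Proof.
move=> wi w0; rewrite /KJ /Rintegral; congr fine.
case/integrableP: wi => mf _.
have mabs : measurable_fun setT 
    ((fun y => `|(J x y * w y)%:E|)%E : Omega -> \bar R).
  exact: measurableT_comp.
apply: ae_eq_integral => //; apply: filterS w0 => y /= wy _.
by rewrite ger0_norm ?mulr_ge0.
Qed.

Lemma KJ_ge0 (w : Omega -> R) (x : Omega) :
  Jint w x -> {ae mu, forall y, 0 <= w y} -> 0 <= KJ mu J w x.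
Proof.
by move=> wi w0; rewrite KJ_abs //; apply/fine_ge0/integral_ge0.
Qed.

Context (rho : R).
Hypothesis J_gt0 : forall x y : Omega, mdist x y < rho -> 0 < J x y.

(** If the integral of the nonnegative [J x y * w y] were zero, then [w] would
    vanish almost everywhere where [J x] is positive, in particular on the ball
    around [x0] of radius [rho - mdist x x0]. *)
Lemma KJ_gt0 (w : Omega -> R) (x x0 : Omega) :
    Jint w x -> {ae mu, forall y, 0 <= w y} -> ess_support w x0 ->
  ball x0 rho x -> 0 < KJ mu J w x.
Proof.
move=> wi w0 x0w; rewrite ballEmdist /= metric_sym => xx0.
rewrite lt_neqAle KJ_ge0 // andbT eq_sym; apply/eqP => K0.
apply: (x0w (rho - mdist x x0)); first by rewrite subr_gt0.
have [mf fi] := integrableP _ _ _ wi.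
have I0 : (\int[mu]_y `|(J x y * w y)%:E| = 0)%E.
  rewrite -[LHS]fineK; first by rewrite -KJ_abs // K0.
  by rewrite ge0_fin_numE //; exact: integral_ge0.
have /(ae_eq_integral_abs mu measurableT mf) := I0.
apply: filterS => y /= /(_ I) [Jw0].
rewrite ballEmdist /= => x0y.
have Jxy : 0 < J x y.
  by apply: J_gt0; apply: le_lt_trans (metric_triangle _ x0 _) _; lra.
by move/eqP: Jw0; rewrite mulf_eq0 gt_eqF //= => /eqP.
Qed.

Hypothesis Hmu : metric_measure mu.

(** A small ball around [x] lies in [ball z rho] and has positive measure. *)
Lemma ess_support_gt0 (w : Omega -> R) (x z : Omega) :
  {ae mu, forall y, ball z rho y -> 0 < w y} -> ball z rho x ->
  ess_support w x.
Proof.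
rewrite ballEmdist /= => wpos zx r r0 w0.
pose s := Num.min r (rho - mdist z x).
have s0 : 0 < s by rewrite lt_min r0 subr_gt0.
have : {ae mu, forall y, ~ ball x s y}.
  apply: filterS2 wpos w0 => y wy w0y.
  rewrite ballEmdist /= lt_min => /andP[xr xrho].
  have : 0 < w y.
    apply: wy.
    by apply: le_lt_trans (metric_triangle _ x _) _; lra.
  have -> : w y = 0 by apply: w0y; rewrite ballEmdist.
  by rewrite ltxx.
have mB : measurable (ball x s) by exact/(mm_borel Hmu)/metric_ball_open.
move=> Bae; have : mu.-negligible (ball x s).
  by apply: negligibleS Bae => y By /=; apply.
move=> /(measure_negligible mB) B0.
by have /andP[] := mm_ball Hmu x s0; rewrite B0 ltxx.
Qed.

(** Inner regularity reduces the claim to the compact subsets [K] of the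
    complement of [P]. Finitely many of the given balls cover [K], so that [K]
    is negligible. The finite cover is used through the covering property of
    compact sets for filters, applied to the filter of conull sets. *)
Lemma ae_of_locally_ae (P : set Omega) : measurable P ->
    (forall x, exists2 r : R, 0 < r & {ae mu, forall y, ball x r y -> P y}) ->
  {ae mu, forall y, P y}.
Proof.
move=> mP locP.
have mCP : measurable (~` P) by exact: measurableC.
suff CP0 : (mu (~` P) <= 0)%E.
  apply/negligibleP; first exact: mCP.
  by apply/eqP; rewrite eq_le measure_ge0 andbT; exact: CP0.
have -> := mm_inner_regular Hmu mCP.
apply: ge_ereal_sup => _ [K [cK KP] <-].
have mK : measurable K.
  rewrite -[K]setCK; apply: measurableC; apply: (mm_borel Hmu).
  by apply: closed_openC; apply: compact_closed => //; exact: metric_hausdorff.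
suff : {ae mu, forall y, K y -> P y}.
  move=> KPae; have : mu.-negligible K.
    apply: negligibleS KPae => y Ky /= KyP.
    by apply: (KP y Ky); exact: KyP.
  by move=> /(measure_negligible mK) ->.
have cov : forall x, K x ->
    \forall x' \near x & y \near almost_everywhere mu, y = x' -> P y.
  move=> x Kx; have [r r0 Br] := locP x.
  exists (ball x r, [set y | ball x r y -> P y]).
    by split => //=; exact: nbhsx_ballx.
  by move=> [x' y] /= [xx' +] yx'; rewrite yx'; apply.
have /compact_near_coveringP Kcov := cK.
have aeF : Filter (almost_everywhere mu) by exact: ae_filter_ringOfSetsType.
have := Kcov _ _ (fun y x => y = x -> P y) aeF cov.
by apply: (@filterS _ _ aeF) => y Ky Kyy; exact: (Ky y Kyy erefl).
Qed.

End Positivity.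

(** * Positivity of the solution on balls *)

Section StrongMaximum.
Context (R : realType) (d : measure_display) (Omega : metricMeasurableType d R).
Context (mu : {measure set Omega -> \bar R}).
Hypothesis Hmu : metric_measure mu.
Context (J : Omega -> Omega -> R) (rho : R).
Hypothesis J_ge0 : forall x y, 0 <= J x y.
Hypothesis J_gt0 : forall x y : Omega, mdist x y < rho -> 0 < J x y.
Hypothesis Omega_conn : chain_connected Omega rho.
Context (F : set_system Omega) {FF : Filter F}.
Hypothesis F_ae : forall P : set Omega, F P -> {ae mu, forall x, P x}.
Context (X : set (Omega -> R)) (N : (Omega -> R) -> \bar R).
Hypothesis NX : lattice_seminorm F X N.
Hypothesis K_int : forall w, X w ->
  F [set x | mu.-integrable setT (fun y => (J x y * w y)%:E)].
Context (h : Omega -> R) (M : R).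
Hypothesis M_ge0 : 0 <= M.
Hypothesis hM : F [set x | h x <= M].
Hypothesis L_X : forall w, X w -> X (KJ_sub_h mu J h w).

Let L_lin a f g w : X f -> X g -> X w ->
  F [set x | w x = a * f x + g x] ->
  F [set x | KJ_sub_h mu J h w x =
             a * KJ_sub_h mu J h f x + KJ_sub_h mu J h g x].
Proof.
move=> Xf Xg Xw wE.
have wae := F_ae wE.
have ifg := @filterI _ F FF _ _ (K_int Xf) (K_int Xg).
apply: filterS3 ifg (K_int Xw) wE => x [/= fi gi] wi wx.
by rewrite /KJ_sub_h (KJ_lin fi gi wi wae) wx; ring.
Qed.

Context (u0 : Omega -> R) (Xu0 : X u0).
Hypothesis u0_ge0 : F [set x | 0 <= u0 x].

Let b := shifted_iter (KJ_sub_h mu J h) u0 M.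

Let bX k : X (b k).
Proof. by apply: (shifted_iter_X NX L_X Xu0). Qed.

(* Since [h <= M], the second term is nonnegative when [b k] is. *)
Let bS k x : b k.+1 x = KJ mu J (b k) x + (M - h x) * b k x.
Proof.
have -> : b k.+1 x = KJ_sub_h mu J h (b k) x + M * b k x by [].
by rewrite /KJ_sub_h; ring.
Qed.

Let b_ge0 k : F [set x | 0 <= b k x].
Proof.
elim: k => [|k IH]; first exact: u0_ge0.
have IHae := F_ae IH.
apply: filterS3 (K_int (bX k)) hM IH => x /= bi hx bx.
rewrite bS addr_ge0 //; first exact: (KJ_ge0 J_ge0 bi IHae).
by rewrite mulr_ge0 // subr_ge0.
Qed.

Let b_step k z : ess_support mu (b k) z ->
  F [set x | ball z rho x -> 0 < b k.+1 x].
Proof.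
move=> bz; apply: filterS3 (K_int (bX k)) hM (b_ge0 k) => x /= bi hx bx zx.
rewrite bS ltr_pwDl //; last by rewrite mulr_ge0 // subr_ge0.
exact: (KJ_gt0 J_ge0 J_gt0 bi (F_ae (b_ge0 k)) bz zx).
Qed.

(* Each step of the chain costs one more application of the operator. *)
Let b_spread x0 x : ess_support mu u0 x0 ->
  exists k, F [set y | ball x rho y -> 0 < b k y].
Proof.
move=> u0x0; have [n [z [z0 <- zz]]] := Omega_conn x0 x.
have : (n <= n)%N by [].
elim: {1 3}n => [|i IH] ile; first by exists 1%N; rewrite z0; exact: b_step.
have [k bk] := IH (ltnW ile).
exists k.+1; apply: b_step; apply: (ess_support_gt0 Hmu (F_ae bk)).
by rewrite ballEmdist /=; exact: zz.
Qed.

(** The strong maximum principle up to the last passage from balls to the whole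
    space, which is immediate for the everywhere filter and needs
    [ae_of_locally_ae] for the almost everywhere one. *)
Theorem expop_gt0_on_balls (x0 : Omega) (t : R) (v : Omega -> R) (x : Omega) :
    ess_support mu u0 x0 -> 0 < t ->
    is_expop X N (KJ_sub_h mu J h) t u0 v ->
  F [set y | ball x rho y -> 0 < v y].
Proof.
move=> u0x0 t0 [Xv vcv]; have [k bk] := b_spread x u0x0.
have := expop_ge_shifted_iter NX L_X L_lin Xu0 k M_ge0 (ltW t0) Xv vcv b_ge0.
move=> /(_ FF); apply: filterS2 bk => y /= by0 bv xy.
rewrite -(pmulr_rgt0 _ (expR_gt0 (M * t))); apply: lt_le_trans bv.
rewrite mulr_gt0 ?by0 // /exp_coeff /= divr_gt0 ?exprn_gt0 //.
Qed.

End StrongMaximum.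


(** * The spaces L^p *)

Section LpSpace.
Context (R : realType) (d : measure_display) (T : measurableType d).
Context (mu : {measure set T -> \bar R}) (p : \bar R).
Hypothesis p1 : (1 <= p)%E.

Lemma le_Lnorm (f g : T -> R) :
    measurable_fun setT f -> measurable_fun setT g ->
    {ae mu, forall x, `|f x| <= `|g x|} ->
  ('N[mu]_p[EFin \o f] <= 'N[mu]_p[EFin \o g])%E.
Proof.
move=> mf mg fg; rewrite unlock.
case: p p1 => [r|_|] //; last first.
  case: ifPn => // _; apply: le_ess_sup.
  by apply: filterS fg => x /=; rewrite lee_fin.
rewrite lee_fin => r1; have r0 : 0 <= r by rewrite (le_trans ler01).
have mpow (w : T -> R) : measurable_fun setT w ->
    measurable_fun setT (fun x => (`|(EFin \o w) x| `^ r)%E).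
  move=> mw; apply: (measurableT_comp (measurable_poweR r)) => //.
  apply: measurableT_comp => //.
  exact/measurable_EFinP.
have i0 (w : T -> R) : (0 <= \int[mu]_x `|(EFin \o w) x| `^ r)%E.
  by apply: integral_ge0 => x _; exact: poweR_ge0.
apply: gt0_ler_poweR.
- by rewrite invr_ge0.
- by rewrite in_itv /= i0 leey.
- by rewrite in_itv /= i0 leey.
apply: ae_ge0_le_integral => //.
- by move=> x _; exact: poweR_ge0.
- exact: mpow.
- by move=> x _; exact: poweR_ge0.
- exact: mpow.
apply: filterS fg => x /= fgx _.
by rewrite lee_fin ge0_ler_powR // nnegrE.
Qed.

Lemma Lfun_mfun (f : T -> R) : f \in Lfun mu p -> measurable_fun setT f.
Proof. by move=> /sub_Lfun_mfun; rewrite inE. Qed.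

Lemma Lfun_finite_norm (f : T -> R) : f \in Lfun mu p -> finite_norm mu p f.
Proof. by move=> /sub_Lfun_finLfun; rewrite inE. Qed.

Lemma Lfun_le (f g : T -> R) : measurable_fun setT f -> g \in Lfun mu p ->
  {ae mu, forall x, `|f x| <= `|g x|} -> f \in Lfun mu p.
Proof.
move=> mf gp fg; apply/andP; split; rewrite inE //=.
apply: le_lt_trans (Lfun_finite_norm gp).
by apply: le_Lnorm => //; exact: Lfun_mfun.
Qed.

(** When the whole space is null, the norm of [h] says nothing, but then any
    constant is a bound almost everywhere. *)
Lemma Lfun_ae_bounded (h : T -> R) : h \in Lfun mu +oo%E ->
  exists2 M : R, 0 <= M & {ae mu, forall x, `|h x| <= M}.
Proof.
move=> /sub_Lfun_finLfun; rewrite inE /= /finite_norm unlock.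
case: ifPn => [mu0 hfin|].
  have ge := ess_sup_ge mu (abse \o (EFin \o h)).
  have s0 : (0 <= ess_sup mu (abse \o (EFin \o h)))%E.
    by apply: ess_sup_gee => //; apply: nearW => x; exact: abse_ge0.
  exists (fine (ess_sup mu (abse \o (EFin \o h)))); first exact: fine_ge0.
  apply: filterS ge => x /=.
  by rewrite -[X in (_ <= X)%E -> _]fineK ?lee_fin // ge0_fin_numE.
rewrite -leNgt => mu0 _; exists 0 => //.
have muT : mu setT = 0%E by apply/eqP; rewrite eq_le mu0 measure_ge0.
by exists setT; split => //; exact: measurableT.
Qed.

Lemma Lfun_mul (h w : T -> R) : h \in Lfun mu +oo%E -> w \in Lfun mu p ->
  (fun x => h x * w x) \in Lfun mu p.
Proof.
move=> hoo wp; have [M M0 hM] := Lfun_ae_bounded hoo.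
have Mw : M *: w \in Lfun mu p.
  have [L0 LL] := Lfun_submod_closed mu p1.
  by rewrite -[_ *: _]addr0; exact: LL.
apply: (Lfun_le _ Mw).
  apply: measurable_funM; last exact: Lfun_mfun.
  by move: hoo => /sub_Lfun_mfun; rewrite inE.
apply: filterS hM => x hMx.
by rewrite /GRing.scale /= !normrM ler_wpM2r // (le_trans hMx) // ler_norm.
Qed.

(** For the order property: the positive part of [g] is dominated by the same
    small elements, so its norm is zero and it vanishes almost everywhere. *)
Lemma Lp_lattice_seminorm : lattice_seminorm (almost_everywhere mu)
  [set v | v \in Lfun mu p] (fun v => 'N[mu]_p[EFin \o v])%E.
Proof.
have [L0 LL] := Lfun_submod_closed mu p1.
split => //=.
- by move=> f /Lfun_finite_norm fp; rewrite ge0_fin_numE ?Lnorm_ge0.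
- by move=> f; exact: Lnorm_ge0.
- move=> f g fp gp; apply: eminkowski => //; exact: Lfun_mfun.
- by move=> a f fp; exact: (LnormZ (Lfun_Sub p1 fp) a).
move=> g gp small.
pose gp0 : T -> R := fun x => Num.max (g x) 0.
have mg := Lfun_mfun gp.
have mgp0 : measurable_fun setT gp0 by exact: measurable_funrpos.
have N0 : ('N[mu]_p[EFin \o gp0] <= 0)%E.
  apply/lee_addgt0Pr => e /small[r [rp Nr] gr]; rewrite add0e.
  apply: le_trans Nr; apply: le_Lnorm => //; first exact: Lfun_mfun.
  apply: filterS gr => x /= gx; rewrite /gp0.
  have [_|g0] := leP (g x) 0; first by rewrite normr0.
  by rewrite gtr0_norm.
have {}N0 : ('N[mu]_p[EFin \o gp0] = 0)%E.
  by apply/eqP; rewrite eq_le N0 Lnorm_ge0.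
have := @Lnorm_eq0_eq0 _ _ _ mu (EFin \o gp0) p _ (lt_le_trans lte01 p1) N0.
move=> H; have {H} : ae_eq mu setT (EFin \o gp0) \0%E.
  by apply: H; exact/measurable_EFinP.
apply: filterS => x /= /(_ I) [] gx.
by rewrite -gx /gp0 le_max lexx.
Qed.

End LpSpace.

(** * Bounded continuous functions *)

Section CbSpace.
Context (R : realType) (d : measure_display) (Omega : metricMeasurableType d R).

Lemma CbP (u : Omega -> R) :
  Cb Omega u <-> continuous u /\ exists B : R, forall x, `|u x| <= B.
Proof.
split=> -[cu]; rewrite /= /bounded_near.
  move=> /pinfty_ex_gt0 [B _ HB]; split => //; exists B => x; exact: HB.
move=> [B HB]; split => //; exists B; split; first exact: num_real.
by move=> M BM x _ /=; rewrite (le_trans (HB x)) // ltW.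
Qed.

Lemma Cb_lin (a : R) (f g : Omega -> R) :
  Cb Omega f -> Cb Omega g -> Cb Omega (a *: f + g).
Proof.
move=> /CbP[cf [A fA]] /CbP[cg [B gB]]; apply/CbP; split.
  move=> x; apply: cvgD (cg x).
  by apply: cvgM (cf x); exact: cvg_cst.
exists (`|a| * A + B) => x; apply: le_trans (ler_normD _ _) _.
by rewrite lerD // normrM ler_wpM2l.
Qed.

Lemma Cb_mul (f g : Omega -> R) :
  Cb Omega f -> Cb Omega g -> Cb Omega (fun x => f x * g x).
Proof.
move=> /CbP[cf [A fA]] /CbP[cg [B gB]]; apply/CbP; split.
  by move=> x; apply: cvgM; [exact: cf|exact: cg].
by exists (A * B) => x; rewrite normrM ler_pM.
Qed.

Lemma sup_norm_le (f : Omega -> R) (B : \bar R) :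
  (forall x, (`|f x|%:E <= B)%E) -> (sup_norm f <= B)%E.
Proof. by move=> fB; apply: ge_ereal_sup => _ [x _ <-]; exact: fB. Qed.

Lemma le_sup_norm (f : Omega -> R) (x : Omega) : (`|f x|%:E <= sup_norm f)%E.
Proof. by apply: ereal_sup_ubound; exists x. Qed.

(** The point [x0] makes the supremum nonnegative: over an empty space it would
    be [-oo]. *)
Lemma Cb_lattice_seminorm (x0 : Omega) :
  lattice_seminorm (globally [set: Omega]) (Cb Omega) (@sup_norm d R Omega).
Proof.
have N0 (f : Omega -> R) : (0 <= sup_norm f)%E.
  by apply: le_trans (le_sup_norm f x0); rewrite lee_fin.
split => //.
- apply/CbP; split; first by move=> x; exact: cvg_cst.
  by exists 0 => x; rewrite normr0.
- exact: Cb_lin.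
- move=> f /CbP[_ [B fB]]; rewrite ge0_fin_numE //.
  apply: (@le_lt_trans _ _ B%:E); last by rewrite ltry.
  by apply: sup_norm_le => x; rewrite lee_fin.
- move=> f g _ _; apply: sup_norm_le => x.
  apply: (@le_trans _ _ (`|f x|%:E + `|g x|%:E)%E).
    by rewrite -EFinD lee_fin ler_normD.
  by apply: leeD; exact: le_sup_norm.
- move=> a f _; rewrite /sup_norm -ereal_supZl //; last first.
    by apply/set0P; exists `|f x0|%:E; exists x0.
  congr ereal_sup; apply/seteqP; split => y /=.
    move=> [x _ <-]; exists `|f x|%:E; first by exists x.
    by rewrite -EFinM -normrM.
  by move=> [_ [x _ <-] <-]; exists x => //; rewrite -EFinM -normrM.
move=> g _ small x _ /=; apply/ler_addgt0Pr => e /small[r [_ Nr] gr].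
rewrite add0r; apply: le_trans (gr x I) _.
by rewrite -lee_fin; apply: le_trans Nr; exact: le_sup_norm.
Qed.

End CbSpace.

(** * The strong maximum principle *)

Theorem theorem4p3 (R : realType) (d : measure_display)
    (Omega : metricMeasurableType d R) (mu : {measure set Omega -> \bar R})
    (Hmu : metric_measure mu)
    (J : Omega -> Omega -> R) (J_ge0 : forall x y : Omega, 0 <= J x y)
    (rho : R) (rho_gt0 : 0 < rho)
    (J_gt0 : forall x y : Omega, mdist x y < rho -> 0 < J x y)
    (Omega_conn : chain_connected Omega rho) :
  (forall p : \bar R, (1 <= p)%E -> KJ_Lp mu p J ->
    forall h : Omega -> R, h \in Lfun mu +oo%E ->
    forall u0 : Omega -> R, u0 \in Lfun mu p ->
      {ae mu, forall x, 0 <= u0 x} -> ~ {ae mu, forall x, u0 x = 0} ->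
    forall u : R -> Omega -> R, solution_Lp mu p J h u0 u ->
    forall t : R, 0 < t -> {ae mu, forall x, 0 < u t x})
  /\
  (KJ_Cb mu J ->
    forall h : Omega -> R, Cb Omega h ->
    forall u0 : Omega -> R, Cb Omega u0 ->
      (forall x, 0 <= u0 x) -> ~ (forall x, u0 x = 0) ->
    forall u : R -> Omega -> R, solution_Cb mu J h u0 u ->
    forall t : R, 0 < t -> forall x : Omega, 0 < u t x).
Proof.
split.
- move=> p p1 [K_int [K_X _]] h hoo u0 u0p u0_ge0 u0_neq0 u sol t t0.
  have [M M0 hM] := Lfun_ae_bounded hoo.
  have [L0 LL] := Lfun_submod_closed mu p1.
  have L_X w : w \in Lfun mu p -> KJ_sub_h mu J h w \in Lfun mu p.
    move=> wp.
    have -> : KJ_sub_h mu J h w = (-1) *: (fun x => h x * w x) + KJ mu J w.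
      by apply/funext => x; rewrite /KJ_sub_h /= scaleN1r addrC.
    by apply: LL; [exact: Lfun_mul|exact: K_X].
  have [x0 u0x0] : exists x0, ess_support mu u0 x0.
    apply: contrapT => no; apply: u0_neq0.
    apply: (ae_of_locally_ae Hmu (P := [set x | u0 x = 0])) => [|x].
      rewrite -[X in measurable X]setTI.
      exact: (Lfun_mfun u0p) measurableT _ (measurable_set1 0).
    apply: contrapT => nox; apply: no; exists x => r r0 xr.
    by apply: nox; exists r.
  have ut := sol t (ltW t0).
  apply: (ae_of_locally_ae Hmu (P := [set x | 0 < u t x])) => [|x].
    have -> : [set x | 0 < u t x] = u t @^-1` `]0, +oo[.
      by apply/seteqP; split => x /=; rewrite in_itv /= andbT.
    rewrite -[X in measurable X]setTI.
    have [utp _] := ut.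
    exact: (Lfun_mfun utp) measurableT _ (measurable_itv _).
  exists rho => //.
  have hMae : almost_everywhere mu [set y | h y <= M].
    by apply: filterS hM => y; apply: le_trans; exact: ler_norm.
  exact: (expop_gt0_on_balls Hmu J_ge0 J_gt0 Omega_conn
    (F := almost_everywhere mu) (fun P FP => FP) (Lp_lattice_seminorm mu p1)
    K_int M0 hMae L_X u0p u0_ge0 x u0x0 t0 ut).
move=> [K_int [K_X _]] h hC u0 u0C u0_ge0 u0_neq0 u sol t t0 x.
have /CbP[_ [M hM]] := hC.
have [x0 u0x0] : exists x0, u0 x0 <> 0.
  apply: contrapT => no; apply: u0_neq0 => y; apply: contrapT => uy.
  by apply: no; exists y.
have M0 : 0 <= M by apply: le_trans (hM x0).
have L_X w : Cb Omega w -> Cb Omega (KJ_sub_h mu J h w).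
  move=> wC.
  have -> : KJ_sub_h mu J h w = (-1) *: (fun y => h y * w y) + KJ mu J w.
    by apply/funext => y; rewrite /KJ_sub_h /= scaleN1r addrC.
  by apply: Cb_lin; [exact: Cb_mul|exact: K_X].
have u0_pos : 0 < u0 x0 by rewrite lt_neqAle u0_ge0 andbT eq_sym; apply/eqP.
have u0s : ess_support mu u0 x0.
  have /CbP[cu0 _] := u0C.
  have : \forall y \near x0, 0 < u0 y.
    exact: (cvgr_gt (u0 x0) (cu0 x0) _ u0_pos).
  move=> /nbhs_ballP[r /= r0 xr].
  apply: (ess_support_gt0 Hmu (z := x0) (rho := r)); last exact: ballxx.
  exact: aeW.
have F_ae (P : set Omega) : globally [set: Omega] P -> {ae mu, forall y, P y}.
  by move=> FP; apply: aeW => y; exact: FP.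
apply: (expop_gt0_on_balls Hmu J_ge0 J_gt0 Omega_conn F_ae
  (Cb_lattice_seminorm x0) _ M0 _ L_X u0C _ x u0s t0 (sol t (ltW t0))) => //=.
- by move=> w wC y _; exact: K_int.
- by move=> y _ /=; apply: le_trans (hM y); exact: ler_norm.
- exact: ballxx.
Qed.
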